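(* Let $\mathcal{P} \subset \Delta(\mathcal{S})^{\mathcal{S}\times\mathcal{A}}$ be a nonempty compact (not necessarily convex) uncertainty set. The following three statements are equivalent. 1. ($\mathcal{P}$ is weakly sa-tractable.) For all $\pi \in \Pi_{\mathsf S}$, all $r \in \mathbb{R}^{\mathcal{S}\times\mathcal{A}}$, all $\gamma \in [0,1)$ and all $\mu \in \Delta(\mathcal{S})$, $$\min_{P \in \mathcal{P}} \mu^\top v^{\pi,P} = \mu^\top \hat u^{\pi}.$$ 2. For all $\pi \in \Pi_{\mathsf S}$, all $r \in \mathbb{R}^{\mathcal{S}\times\mathcal{A}}$ and all $\gamma \in [0,1)$, there exists $\hat P \in \mathcal{P}$ such that $\hat u^{\pi} = v^{\pi,\hat P}$. 3. For all $V \in \mathbb{R}^{\mathcal{S}}$, $$\bigcap_{(s,a) \in \mathcal{S}\times\mathcal{A}} \arg\min_{P \in \mathcal{P}} \langle P_{sa}, V\rangle \neq \emptyset .$$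
   Context: $\mathcal{S}$ (states) and $\mathcal{A}$ (actions) are finite nonempty sets; $\Delta(E)$ denotes the set of probability distributions on a finite set $E$. An uncertainty set is a subset $\mathcal{P} \subset \Delta(\mathcal{S})^{\mathcal{S}\times\mathcal{A}}$; its elements are written $P=(P_{sa})_{(s,a)}$ with $P_{sa}\in\Delta(\mathcal{S})\subset\mathbb{R}^{\mathcal{S}}$; $\langle\cdot,\cdot\rangle$ is the usual scalar product. Stationary policies: $\Pi_{\mathsf S}=\Delta(\mathcal{A})^{\mathcal{S}}$, $\pi=(\pi_{sa})$. Here rewards are independent of the next state: $r=(r_{sa})\in\mathbb{R}^{\mathcal{S}\times\mathcal{A}}$. For $\gamma\in[0,1)$, $\pi\in\Pi_{\mathsf S}$ and $P\in\mathcal{P}$, the value function $v^{\pi,P}\in\mathbb{R}^{\mathcal{S}}$ is $v^{\pi,P}_s=\mathbb{E}^{\pi,P}\big[\sum_{t\ge 0}\gamma^t r_{s_ta_t}\,\big|\,s_0=s\big]$ (with $0^0=1$), where $a_t\sim\pi_{s_t}$ and $s_{t+1}\sim P_{s_ta_t}$; equivalently it is the unique solution of $v_s=\sum_a\pi_{sa}(r_{sa}+\gamma P_{sa}^\top v)$ for all $s$. The vector $\hat u^{\pi}\in\mathbb{R}^{\mathcal{S}}$ (depending on $\pi,r,\gamma,\mathcal{P}$) is the unique vector satisfying $\hat u^\pi_s=\sum_{a\in\mathcal{A}}\pi_{sa}\min_{P\in\mathcal{P}}(r_{sa}+\gamma P_{sa}^\top \hat u^\pi)$ for all $s\in\mathcal{S}$.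 *)

(* Defs.v *)
From HB Require Import structures.
From mathcomp Require Import all_boot all_order all_algebra.
From mathcomp Require Import all_classical all_reals all_analysis.

Set Implicit Arguments.
Unset Strict Implicit.
Unset Printing Implicit Defensive.

Import Order.TTheory GRing.Theory Num.Theory.
Import numFieldNormedType.Exports.

Local Open Scope classical_set_scope.
Local Open Scope ring_scope.

Definition simplex {R : realType} (E : finType) : set (E -> R) :=
  [set p | (forall e, 0 <= p e) /\ \sum_(e : E) p e = 1].

Definition dotp {R : realType} {E : finType} (x y : E -> R) : R :=
  \sum_(e : E) x e * y e.

Definition argmin {R : realType} {T : Type} (D : set T) (f : T -> R) : set T :=
  [set x | D x /\ forall y, D y -> f x <= f y].

(* [m = min_(x in D) f x], the minimum being attained. *)
Definition is_min {R : realType} {T : Type} (D : set T) (f : T -> R) (m : R) :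
    Prop :=
  exists2 x, argmin D f x & f x = m.

(* Stationary policies, [pi s a] being the probability of [a] in state [s]. *)
Definition policies {R : realType} (S A : finType) : set (S -> A -> R) :=
  [set pi | forall s, simplex (pi s)].

(* As [S * A] and [S] are finite, the product topology carried by this type is
   the usual topology of a finite-dimensional real vector space. *)
Definition kernel_space (R : realType) (S A : finType) :=
  {ptws (S * A)%type -> {ptws S -> R}}.

(* [Z t] is the state-action pair at time [t] of a process which starts in [s],
   with actions drawn from [pi] and next states drawn from [P]: its
   finite-dimensional laws are given on every history [h 0, ..., h n]. *)
Definition is_trajectory {R : realType} {S A : finType} (pi : S -> A -> R)
    (P : S * A -> S -> R) (s : S) {d : measure_display} {T : measurableType d}
    (Pr : probability T R) (Z : nat -> T -> S * A) : Prop :=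
  (forall t x, measurable [set w | Z t w = x]) /\
  (forall (n : nat) (h : nat -> S * A),
     Pr [set w | forall t, (t <= n)%N -> Z t w = h t] =
     ((((h 0%N).1 == s)%:R * \prod_(t < n.+1) pi (h t).1 (h t).2
                           * \prod_(t < n) P (h t) (h t.+1).1)%:E)%E).

Definition discounted_return {R : realType} {S A : finType} (gamma : R)
    (r : S * A -> R) (z : nat -> S * A) : R :=
  limn (series (fun t => gamma ^+ t * r (z t))).

(* Expected discounted return from [s].  For [pi] and [P] stochastic and
   [0 <= gamma < 1], a trajectory exists on some probability space
   (Ionescu-Tulcea) and the expectation depends only on its law, so that [get]
   selects the only element of the set. *)
Definition value {R : realType} {S A : finType} (gamma : R) (r : S * A -> R)
    (pi : S -> A -> R) (P : S * A -> S -> R) : S -> R :=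
  fun s => get [set x : R |
    exists (d : measure_display) (T : measurableType d) (Pr : probability T R)
      (Z : nat -> T -> S * A),
      is_trajectory pi P s Pr Z /\
      ('E_Pr[fun w => discounted_return gamma r (fun t => Z t w)] = x%:E)%E].

Definition sa_robust_bellman {R : realType} {S A : finType}
    (U : set (kernel_space R S A)) (gamma : R) (r : S * A -> R)
    (pi : S -> A -> R) (u : S -> R) : Prop :=
  forall s, exists m : A -> R,
    (forall a, is_min U (fun P => r (s, a) + gamma * dotp (P (s, a)) u) (m a))
    /\ u s = \sum_(a : A) pi s a * m a.

(* For [U] nonempty, compact and made of transition kernels, [pi] a policy and
   [0 <= gamma < 1], the equation has exactly one solution, by contraction. *)
Definition uhat {R : realType} {S A : finType} (U : set (kernel_space R S A))
    (gamma : R) (r : S * A -> R) (pi : S -> A -> R) : S -> R :=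
  get [set u : S -> R | sa_robust_bellman U gamma r pi u].

Definition weakly_sa_tractable {R : realType} {S A : finType}
    (U : set (kernel_space R S A)) : Prop :=
  forall (pi : S -> A -> R) (r : S * A -> R) (gamma : R) (mu : S -> R),
    policies pi -> 0 <= gamma < 1 -> simplex mu ->
    is_min U (fun P => dotp mu (value gamma r pi P))
             (dotp mu (uhat U gamma r pi)).

(* Main.v *)
Require Import Defs.
From HB Require Import structures.
From mathcomp Require Import all_boot all_order all_algebra.
From mathcomp Require Import all_classical all_reals all_analysis.
From mathcomp Require Import measurable_realfun ring lra.

Set Implicit Arguments.
Unset Strict Implicit.
Unset Printing Implicit Defensive.

Import Order.TTheory GRing.Theory Num.Theory.
Import numFieldNormedType.Exports.

Local Open Scope classical_set_scope.
Local Open Scope ring_scope.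

(** Two facts about Bellman equations carry the proof.

    Value functions are fixed points.  The expected discounted return from [s]
    is the fixed point of the Bellman operator of [P] ([value_bellman]), that
    is, the solution of the robust equation of the singleton [[set P]]
    ([sa_robust_bellman1]).  As [value] is a [get] over all trajectories on all
    probability spaces, this needs a trajectory to exist ([chain_exists]) and
    the expectation to be the same for all of them
    ([expectation_discounted_return]).

    Solutions of robust equations are antitone in the uncertainty set
    ([sa_robust_bellman_le]): if [V `<=` U], the solution for [U] is at most
    the solution for [V].  With [V = U] this is uniqueness, and with
    [V = [set P]] it says that [uhat] is a lower bound of all the value
    functions.

    The equivalences follow.  If one kernel minimizes every [dotp (P sa) u] for
    [u = uhat], then the robust equation of [u] is the Bellman equation of that
    kernel, so [uhat] is its value function.  If [uhat] is the value function
    of some kernel, that kernel attains the lower bound [dotp mu uhat] for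
    every [mu].  Conversely, if the lower bound is attained for the uniform
    [mu], two ordered functions have the same average with positive weights,
    hence are equal.  Finally, given [u], choose the discount factor [1/2], the
    uniform policy and rewards for which every action in [s] has robust value
    exactly [u s]; then [uhat = u], and a kernel whose value function is [u]
    must attain each minimum because all the action probabilities are
    positive. *)

(** * Discounting operators *)

Lemma dotp_simplexB {R : realType} {E : finType} (p u v : E -> R) (M : R) :
  simplex p -> (forall e, u e - v e <= M) -> dotp p u - dotp p v <= M.
Proof.
move=> [p0 p1] uvM; rewrite /dotp -sumrB -[M]mul1r -p1 mulr_suml.
by apply: ler_sum => e _; rewrite -mulrBr ler_wpM2l.
Qed.

Lemma is_min_unique {R : realType} {T : Type} (D : set T) (f : T -> R) m m' :
  is_min D f m -> is_min D f m' -> m = m'.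
Proof.
move=> [x [Dx xmin] <-] [y [Dy ymin] <-].
by apply/eqP; rewrite eq_le xmin// ymin.
Qed.

(** Blackwell's conditions in one formula: as [M] may have any sign, [M = 0] gives
    monotonicity, and exchanging [u] and [v] gives a [gamma]-contraction for the
    sup norm. *)
Definition blackwell_discounting {R : realType} {S : finType} (gamma : R)
    (F : (S -> R) -> S -> R) : Prop :=
  forall u v M, (forall s, u s - v s <= M) ->
  forall s, F u s - F v s <= gamma * M.

Section contraction.
Context {R : realType} {S : finType} (gamma : R).
Hypothesis gamma01 : 0 <= gamma < 1.

(** The largest value [d s1] satisfies [d s1 <= gamma * d s1].  Applied to the
    difference of two fixed points, this is a comparison principle. *)
Lemma discounted_le0 (d : S -> R) :
  (forall M, (forall s, d s <= M) -> forall s, d s <= gamma * M) ->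
  forall s, d s <= 0.
Proof.
case/andP: gamma01 => g0 g1 dP s.
have [s1 _ dmax] := @Order.TotalTheory.arg_maxP _ _ S s xpredT d isT.
have /(_ s1) : forall s, d s <= gamma * d s1 by apply: dP => t; exact: dmax.
move=> dg; apply: le_trans (dmax s isT) _.
by rewrite leNgt; apply/negP => d0; move: dg; rewrite leNgt gtr_pMl ?g1.
Qed.

Context (F : (S -> R) -> S -> R).
Hypothesis ctrF : blackwell_discounting gamma F.

Let ctrF_norm u v M : (forall s, `|u s - v s| <= M) ->
  forall s, `|F u s - F v s| <= gamma * M.
Proof.
move=> uvM s; rewrite ler_norml -lerNl opprB.
rewrite !ctrF// => t; apply: le_trans (uvM t); first exact: ler_norm.
by rewrite distrC ler_norm.
Qed.

(** Banach's fixed point theorem for the sup norm on [S -> R]: successive iterates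
    differ by at most a geometric sequence. *)
Lemma blackwell_fixpoint (u0 : S -> R) : exists2 w : S -> R,
  F w = w & forall s, (fun n => iter n F u0 s) @ \oo --> w s.
Proof.
case/andP: gamma01 => g0 g1.
pose x n s := iter n F u0 s.
pose M := \sum_t `|F u0 t - u0 t|.
have dx n s : `|x n.+1 s - x n s| <= M * gamma ^+ n.
  elim: n s => [|n IHn] s.
    by rewrite expr0 mulr1 /M (bigD1 s)//= lerDl sumr_ge0.
  by rewrite exprS mulrCA; exact: ctrF_norm.
have cvx s : cvgn (x ^~ s).
  suff : cvgn (series (telescope (x ^~ s))).
    move=> c; have -> : x ^~ s = (fun n => x 0%N s + series (telescope (x ^~ s)) n).
      by apply/funext => n; rewrite -eq_sum_telescope.
    by apply: is_cvgD => //; exact: is_cvg_cst.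
  apply: normed_cvg; apply: (@series_le_cvg _ _ (geometric M gamma)) => //.
  - by move=> n /=; rewrite normr_ge0.
  - by move=> n; rewrite mulr_ge0 ?exprn_ge0// sumr_ge0.
  - by move=> n; exact: dx.
  - by apply: is_cvg_geometric_series; rewrite ger0_norm.
pose w s := limn (x ^~ s).
have xw s : x ^~ s @ \oo --> w s by exact: cvx.
exists w => //; apply/funext => s.
apply: (@cvg_unique _ (@Rhausdorff R) ((fun n => x n.+1 s) @ \oo)); last first.
  by have := xw s; rewrite -(cvg_shiftS (x ^~ s)).

apply/cvgrPdist_le => e e0.
have : \forall n \near \oo, forall t, `|w t - x n t| <= e.
  by apply: filter_forall => t; move/cvgrPdist_le : (xw t); exact.
apply: filterS => n wx; apply: le_trans (ctrF_norm wx s) _.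
by apply: ler_piMl; exact: ltW.
Qed.
End contraction.

(** * The robust Bellman equation *)

Lemma is_min_compact {R : realType} {T : topologicalType} (D : set T)
    (f : T -> R) :
  D !=set0 -> compact D -> continuous f -> exists m, is_min D f m.
Proof.
move=> D0 cD cf.
have [|x + xmin] := @compact_EVT_min _ _ f D D0 cD.
  exact: continuous_subspaceT.
rewrite inE => Dx; exists (f x), x => //.
by split=> // y Dy; apply: xmin; rewrite inE.
Qed.

Section robust.
Context {R : realType} {S A : finType}.
Implicit Types (U V : set (kernel_space R S A)) (P : kernel_space R S A).
Implicit Types (r : S * A -> R) (pi : S -> A -> R) (u v : S -> R).

Lemma dotp_kernel_continuous (sa : S * A) u :
  continuous (fun P : kernel_space R S A => dotp (P sa) u).
Proof.
apply: continuous_big => [|s _ P]; first exact: add_continuous.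
have proj1 : continuous (fun Q : kernel_space R S A => Q sa).
  exact: (@proj_continuous _ (fun=> {ptws S -> R}) sa).
have proj2 : continuous (fun q : {ptws S -> R} => q s).
  exact: (@proj_continuous _ (fun=> R : topologicalType) s).
have c := @continuous_comp _ _ _ _ _ P (proj1 P) (proj2 (P sa)).
by apply: continuousM; [exact: c|exact: cst_continuous].
Qed.

Definition uncertainty_set U : Prop :=
  [/\ U !=set0, compact U & forall P, U P -> forall sa, simplex (P sa)].

Lemma uncertainty_set1 P :
  (forall sa, simplex (P sa)) -> uncertainty_set [set P].
Proof.
by move=> PP; split; [exists P|exact: compact_set1|move=> _ ->].
Qed.

Lemma bellman_min_exists U gamma r u sa : uncertainty_set U ->
  exists m, is_min U (fun P => r sa + gamma * dotp (P sa) u) m.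
Proof.
move=> [U0 cU _]; apply: is_min_compact => // P.
have affine : continuous (fun x : R => r sa + gamma * x).
  move=> x; apply: cvgD; first exact: cvg_cst.
  by apply: cvgMl_tmp; exact: cvg_id.
have c := @continuous_comp _ _ _ _ _ P (@dotp_kernel_continuous sa u P) (affine _).
exact: c.
Qed.

(** A kernel which attains the minimum over [V] is a competitor for the minimum
    over [U], which transfers the bound on [u - v] to the minima. *)
Lemma bellman_min_leB U V gamma r u v sa mu mv M :
    (forall P, V P -> U P /\ simplex (P sa)) -> 0 <= gamma ->
    is_min U (fun P => r sa + gamma * dotp (P sa) u) mu ->
    is_min V (fun P => r sa + gamma * dotp (P sa) v) mv ->
    (forall s, u s - v s <= M) ->
  mu - mv <= gamma * M.
Proof.
move=> VU g0 [P [_ Pmin] <-] [Q [/VU[UQ sQ] _] <-] uvM.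
have := Pmin _ UQ; have := ler_wpM2l g0 (dotp_simplexB sQ uvM).
by rewrite mulrBr; lra.
Qed.

Lemma policy_leB pi s (m m' : A -> R) M : policies pi ->
  (forall a, m a - m' a <= M) ->
  \sum_a pi s a * m a - \sum_a pi s a * m' a <= M.
Proof. by move=> /(_ s) spi; exact: (dotp_simplexB spi). Qed.

(** Enlarging the uncertainty set lowers the solution: by [bellman_min_leB] the
    difference [u - v] satisfies the hypothesis of [discounted_le0]. *)
Lemma sa_robust_bellman_le U V gamma r pi u v :
    V `<=` U -> (forall P, V P -> forall sa, simplex (P sa)) ->
    policies pi -> 0 <= gamma < 1 ->
    sa_robust_bellman U gamma r pi u -> sa_robust_bellman V gamma r pi v ->
  forall s, u s <= v s.
Proof.
move=> VU sV ppi g01 bu bv s; rewrite -subr_le0.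
move: s; apply: (discounted_le0 g01) => M uvM s.
have [m [mP ->]] := bu s; have [m' [m'P ->]] := bv s.
apply: policy_leB => // a; have /andP[g0 _] := g01.
by apply: bellman_min_leB (mP a) (m'P a) uvM => // P VP; split; auto.
Qed.

Lemma sa_robust_bellman_unique U gamma r pi u v : uncertainty_set U ->
    policies pi -> 0 <= gamma < 1 ->
    sa_robust_bellman U gamma r pi u -> sa_robust_bellman U gamma r pi v ->
  u = v.
Proof.
move=> [_ _ sU] ppi g01 bu bv; apply/funext => s; apply/eqP; rewrite eq_le.
by rewrite !(@sa_robust_bellman_le U U gamma r pi).
Qed.

Lemma sa_robust_bellman_exists U gamma r pi : uncertainty_set U ->
    policies pi -> 0 <= gamma < 1 ->
  exists u, sa_robust_bellman U gamma r pi u.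
Proof.
move=> HU ppi g01.
have [m mP] := choice (fun x : (S * A) * (S -> R) =>
  bellman_min_exists gamma r x.2 x.1 HU).
pose F u s := \sum_a pi s a * m ((s, a), u).
have [|w Fw _] := @blackwell_fixpoint _ _ gamma g01 F _ (fun=> 0).
  move=> u v M uvM s; apply: policy_leB => // a.
  have [[_ _ sU] /andP[g0 _]] := (HU, g01).
  by apply: bellman_min_leB (mP (s, a, u)) (mP (s, a, v)) uvM => // P UP; auto.
exists w => s; exists (fun a => m ((s, a), w)); split; last by rewrite -{1}Fw.
by move=> a; exact: (mP ((s, a), w)).
Qed.

Lemma uhatP U gamma r pi : uncertainty_set U -> policies pi ->
  0 <= gamma < 1 -> sa_robust_bellman U gamma r pi (uhat U gamma r pi).
Proof.
by move=> HU ppi g01; apply: getPex; exact: sa_robust_bellman_exists.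
Qed.

Lemma uhat_unique U gamma r pi u : uncertainty_set U -> policies pi ->
    0 <= gamma < 1 -> sa_robust_bellman U gamma r pi u ->
  uhat U gamma r pi = u.
Proof.
move=> HU ppi g01; apply: sa_robust_bellman_unique => //; exact: uhatP.
Qed.

Lemma sa_robust_bellman1 P gamma r pi v :
  sa_robust_bellman [set P] gamma r pi v <->
  forall s, v s = \sum_a pi s a * (r (s, a) + gamma * dotp (P (s, a)) v).
Proof.
split=> bv s.
  have [m [mP ->]] := bv s; apply: eq_bigr => a _; congr (_ * _).
  by have [_ [-> _] <-] := mP a.
eexists; split; last exact: bv.
by move=> a /=; exists P => //; split=> // _ ->.
Qed.

End robust.

(** * Markov chains on a finite type *)

Definition is_chain {R : realType} {X : finType} (p : X -> R)
    (K : X -> X -> R) {d : measure_display} {T : measurableType d}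
    (Pr : probability T R) (Z : nat -> T -> X) : Prop :=
  (forall t x, measurable [set w | Z t w = x]) /\
  (forall (n : nat) (h : nat -> X),
     Pr [set w | forall t, (t <= n)%N -> Z t w = h t] =
     (p (h 0%N) * \prod_(t < n) K (h t) (h t.+1))%:E).

Section refinement.
Context {R : realType} {X : finType}.
Implicit Types (p : X -> R) (u : R).

(** The law [p] cuts [[0, 1)] into consecutive half-open cells of lengths [p x],
    in the order of the enumeration of [X]; [cumul p] lists their endpoints. *)
Definition cumul p (k : nat) : R := \sum_(x : X | (enum_rank x < k)%N) p x.

Lemma cumul_le p k l : simplex p -> (k <= l)%N -> cumul p k <= cumul p l.
Proof.
move=> [p0 _] kl; rewrite /cumul [leRHS](bigID (fun x => (enum_rank x < k)%N))/=.
rewrite [X in _ <= X + _](eq_bigl (fun x => (enum_rank x < k)%N)).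
  by rewrite lerDl sumr_ge0.
by move=> x /=; case: ltnP => //= lx; rewrite ltnNge (leq_trans kl lx).
Qed.

Lemma cumulS p x : cumul p (enum_rank x).+1 = cumul p (enum_rank x) + p x.
Proof.
rewrite /cumul (bigD1 x)/= ?ltnSn// addrC; congr (_ + _); apply: eq_bigl => y.
rewrite ltnS leq_eqVlt -[y == x](inj_eq enum_rank_inj).
rewrite -[_ == enum_rank x]/(_ == _ :> nat).
by case: (ltngtP (enum_rank y) (enum_rank x)).
Qed.

Lemma cumul0 p : cumul p 0 = 0.
Proof. by rewrite /cumul big_pred0. Qed.

Lemma cumul_card p : simplex p -> cumul p #|X| = 1.
Proof.
by move=> [_ <-]; apply: eq_bigl => x; rewrite ltn_ord.
Qed.

Lemma cumul_itv p x : simplex p ->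
  0 <= cumul p (enum_rank x) /\ cumul p (enum_rank x) + p x <= 1.
Proof.
move=> sp; rewrite -cumulS -(cumul_card sp) -(cumul0 p).
by split; apply: cumul_le.
Qed.

Definition in_cell p u x : bool :=
  cumul p (enum_rank x) <= u < cumul p (enum_rank x) + p x.

Lemma in_cell_unique p u x y : simplex p ->
  in_cell p u x -> in_cell p u y -> x = y.
Proof.
move=> sp /andP[x1 x2] /andP[y1 y2]; rewrite -cumulS in x2; rewrite -cumulS in y2.
apply: enum_rank_inj; apply/val_inj/eqP; rewrite eqn_leq /=.
apply/andP; split; rewrite leqNgt; apply/negP => /(cumul_le sp) h.
  by have := lt_le_trans y2 (le_trans h x1); rewrite ltxx.
by have := lt_le_trans x2 (le_trans h y1); rewrite ltxx.
Qed.

Lemma in_cell_exists p u : simplex p -> 0 <= u < 1 -> exists x, in_cell p u x.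
Proof.
move=> sp /andP[u0 u1].
have exk : exists k, u < cumul p k by exists #|X|; rewrite cumul_card.
 case: (ex_minnP exk) => -[|k] uk kmin; first by move: uk; rewrite cumul0 ltNge u0.
have kX : (k < #|X|)%N by apply: kmin; rewrite cumul_card.
exists (enum_val (Ordinal kX)).
rewrite /in_cell -cumulS enum_valK /= uk andbT leNgt.
by apply/negP => /kmin; rewrite ltnn.
Qed.

Definition draw (x0 : X) p u : X := odflt x0 [pick x | in_cell p u x].

Lemma drawP x0 p u x : simplex p -> 0 <= u < 1 ->
  draw x0 p u = x <-> in_cell p u x.
Proof.
move=> sp u01; rewrite /draw; case: pickP => [y uy|no] /=.
  by split=> [<-//|]; exact: in_cell_unique uy.
by have [y] := in_cell_exists sp u01; rewrite no.
Qed.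

(** A point [u] of [[0, 1)] yields the [x] whose cell contains it, together with
    the position of [u] in that cell, rescaled to [[0, 1)] and thus ready to
    provide the next draw. *)
Definition refine (x0 : X) p u : X * R :=
  let x := draw x0 p u in (x, (u - cumul p (enum_rank x)) / p x).

End refinement.

Section chain_construction.
Context {R : realType} {X : finType} (x0 : X) (p : X -> R) (K : X -> X -> R).
Hypothesis sp : simplex p.
Hypothesis sK : forall x, simplex (K x).

(** The whole chain is a function of one point [w] of [[0, 1)], from which the
    successive draws are extracted. *)
Definition chain_state (t : nat) (w : R) : X * R :=
  iter t (fun xu => refine x0 (K xu.1) xu.2) (refine x0 p w).

Fixpoint cyl_width (n : nat) (h : nat -> X) : R :=
  if n is m.+1 then cyl_width m h * K (h m) (h n) else p (h 0%N).

Fixpoint cyl_left (n : nat) (h : nat -> X) : R :=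
  if n is m.+1
  then cyl_left m h + cyl_width m h * cumul (K (h m)) (enum_rank (h n))
  else cumul p (enum_rank (h 0%N)).

Lemma cyl_widthE n h :
  cyl_width n h = p (h 0%N) * \prod_(t < n) K (h t) (h t.+1).
Proof.
elim: n => [|n IHn] /=; first by rewrite big_ord0 mulr1.
by rewrite big_ord_recr /= mulrA IHn.
Qed.

Lemma cyl_width_ge0 n h : 0 <= cyl_width n h.
Proof.
by elim: n => [|n IHn] /=; rewrite ?mulr_ge0//; [case: sp|case: (sK (h n))].
Qed.

Lemma cyl_sub n h :
  0 <= cyl_left n h /\ cyl_left n h + cyl_width n h <= 1.
Proof.
elim: n => [|n [l0 lw1]] /=; first exact: cumul_itv.
have w0 := cyl_width_ge0 n h.
have [c0 c1] := cumul_itv (h n.+1) (sK (h n)).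
split; first by rewrite addr_ge0// mulr_ge0.
apply: le_trans lw1; rewrite -addrA lerD2l -mulrDr.
by rewrite ler_piMr.
Qed.

(** The history [h 0, ..., h n] occurs exactly on an interval whose length is the
    probability of that history.  The induction also needs the position of [w]
    in this interval, which determines the next draw. *)
Lemma chain_cylP n h w : 0 <= w < 1 ->
  (forall t, (t <= n)%N -> (chain_state t w).1 = h t) <->
  cyl_left n h <= w < cyl_left n h + cyl_width n h.
Proof.
move=> w01.
suff [] : ((forall t, (t <= n)%N -> (chain_state t w).1 = h t) <->
    cyl_left n h <= w < cyl_left n h + cyl_width n h) /\
  (cyl_left n h <= w < cyl_left n h + cyl_width n h ->
    (chain_state n w).2 = (w - cyl_left n h) / cyl_width n h) by [].
elim: n => [|n [IH1 IH2]].
  have dP := drawP x0 (h 0%N) sp w01.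
  split=> [|wh]; last by rewrite /= (dP.2 wh).
  split=> [hw|wh [|//] _]; first by apply/dP; exact: (hw 0%N).
  exact/dP.
have w0 := cyl_width_ge0 n h.
have [c0 c1] := cumul_itv (h n.+1) (sK (h n)).
have sub : cyl_left n.+1 h <= w < cyl_left n.+1 h + cyl_width n.+1 h ->
    cyl_left n h <= w < cyl_left n h + cyl_width n h.
  by move=> /= /andP[]; nra.
have step : cyl_left n h <= w < cyl_left n h + cyl_width n h ->
    ((chain_state n.+1 w).1 = h n.+1 <->
     cyl_left n.+1 h <= w < cyl_left n.+1 h + cyl_width n.+1 h) /\
    (cyl_left n.+1 h <= w < cyl_left n.+1 h + cyl_width n.+1 h ->
     (chain_state n.+1 w).2 = (w - cyl_left n.+1 h) / cyl_width n.+1 h).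
  move=> wn.
  have e1 : (chain_state n w).1 = h n by apply: (IH1.2 wn).
  have e2 := IH2 wn.
  have eS : chain_state n.+1 w =
      refine x0 (K (h n)) ((w - cyl_left n h) / cyl_width n h).
    by rewrite /chain_state iterS -/(chain_state n w) e1 e2.
  have W0 : 0 < cyl_width n h by move/andP: wn => [? ?]; lra.
  have u01 : 0 <= (w - cyl_left n h) / cyl_width n h < 1.
    by rewrite divr_ge0//= ?ltr_pdivrMr ?mul1r//; move/andP: wn => [? ?]; lra.
  have := drawP x0 (h n.+1) (sK (h n)) u01.
  rewrite /in_cell ler_pdivlMr// ltr_pdivrMr// => dP.
  have eI : (cyl_left n.+1 h <= w < cyl_left n.+1 h + cyl_width n.+1 h) =
    (cumul (K (h n)) (enum_rank (h n.+1)) * cyl_width n h <= w - cyl_left n h <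
    (cumul (K (h n)) (enum_rank (h n.+1)) + K (h n) (h n.+1)) * cyl_width n h).
    by rewrite /= lerBrDl ltrBlDl mulrDl addrA ![_ * cyl_width n h]mulrC.
  rewrite eI eS /=; split=> // /dP ->.
  have [->|k0] := eqVneq (K (h n) (h n.+1)) 0; first by rewrite mulr0 !invr0 !mulr0.
  have Wn0 : cyl_width n h != 0 by rewrite gt_eqF.
  by field; rewrite k0.
split; last by move=> wn1; case: (step (sub wn1)) => _; exact.
split=> [hw|wn1].
  have wn : cyl_left n h <= w < cyl_left n h + cyl_width n h.
    by apply/IH1 => t tn; apply: hw; exact: leqW.
  by apply/(step wn).1; exact: hw.
move=> t; rewrite leq_eqVlt => /orP[/eqP ->|]; first exact/(step (sub wn1)).1.
by move: t; apply/IH1; exact: sub.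
Qed.

End chain_construction.

Lemma uniform01_itv {R : realType} (l w : R) : 0 <= l -> 0 <= w -> l + w <= 1 ->
  uniform_prob (@ltr01 R) `[l, l + w[ = w%:E.
Proof.
move=> l0 w0 lw1; rewrite /uniform_prob (eq_integral (cst 1%E)); last first.
  move=> x; rewrite inE /= in_itv/= => /andP[lx xlw].
  rewrite /uniform_pdf subr0 invr1 (le_trans l0 lx)/=.
  by rewrite ltW// (lt_le_trans xlw).
rewrite integral_cst//= mul1e lebesgue_measure_itv/= lte_fin ltrDl.
case: ltgtP w0 => // [_ _|<- _ //].
by rewrite -EFinB addrAC subrr add0r.
Qed.

(** Under the uniform law on [[0, 1]], the process [chain_state] has the required
    finite-dimensional laws by [chain_cylP]. *)
Theorem chain_exists {R : realType} {X : finType} (p : X -> R)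
    (K : X -> X -> R) : simplex p -> (forall x, simplex (K x)) ->
  exists (d : measure_display) (T : measurableType d) (Pr : probability T R)
    (Z : nat -> T -> X), is_chain p K Pr Z.
Proof.
move=> sp sK.
have [x0 _] : exists x0 : X, True.
  have [x _] : exists x, in_cell p 0 x.
    by apply: in_cell_exists; rewrite ?lexx ?ltr01.
  by exists x.
(* [chain_cylP] speaks of [[0, 1)] only: other points are sent to [0], so that the
   part of a cylinder outside [[0, 1)] is all or nothing, hence measurable. *)
pose clip (w : R) : R := if 0 <= w < 1 then w else 0.
have clip01 w : 0 <= clip w < 1 by rewrite /clip; case: ifP; rewrite // lexx ltr01.
pose Z t (w : measurableTypeR R) := (chain_state x0 p K t (clip w)).1.
pose Pr : probability (measurableTypeR R) R := uniform_prob (@ltr01 R).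
pose I : set (measurableTypeR R) := `[0, 1[%classic.
have mI : measurable I by exact: measurable_itv.
have PI : Pr (~` I) = 0%E.
  have PI1 : Pr I = 1%E.
    by have := @uniform01_itv R 0 1; rewrite add0r; apply.
  by rewrite probability_setC// PI1 subee.
pose C n h : set (measurableTypeR R) :=
  [set w | forall t, (t <= n)%N -> Z t w = h t].
have CI n h : C n h `&` I =
    `[cyl_left p K n h, cyl_left p K n h + cyl_width p K n h[%classic.
  apply/seteqP; split=> w /=; rewrite in_itv/=.
    move=> [Cw]; rewrite /I /= in_itv/= => w01.
    by apply/(chain_cylP x0 sp sK n h w01) => t tn; rewrite -Cw// /Z /clip w01.
  move=> /[dup] lw /andP[lw1 lw2]; have [l0 w1] := cyl_sub sp sK n h.
  have w01 : 0 <= w < 1 by rewrite (le_trans l0 lw1) (lt_le_trans lw2 w1).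
  split; last by rewrite /I /= in_itv.
  move=> t tn; rewrite /Z /clip w01.
  by move: t tn; apply/(chain_cylP x0 sp sK n h w01).
have CnI n h : C n h `\` I = ~` I \/ C n h `\` I = set0.
  have Z0 t w : ~ I w -> Z t w = Z t 0.
    rewrite /I /= in_itv/= => /negP nw.
    by rewrite /Z /clip (negbTE nw) lexx ltr01.
  have [C0|nC0] := pselect (C n h 0); [left|right].
    apply/seteqP; split=> [w []//|w nI]; split=> // t tn.
    by rewrite Z0//; exact: C0.
  apply/seteqP; split=> // w [Cw nI]; apply: nC0 => t tn.
  by rewrite -(Z0 t w)//; exact: Cw.
have mCnI n h : measurable (C n h `\` I).
  by case: (CnI n h) => ->; [exact: measurableC|exact: measurable0].
have mCI n h : measurable (C n h `&` I) by rewrite CI; exact: measurable_itv.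
have mC n h : measurable (C n h).
  by rewrite -(setUIDK (C n h) I); exact: measurableU.
have PC n h : Pr (C n h) = (cyl_width p K n h)%:E.
  rewrite (measureDI Pr (mC n h) mI) [X in (X + _)%E](_ : _ = 0%E); last first.
    by case: (CnI n h) => -> //; exact: measure0.
  rewrite add0e CI; have [l0 w1] := cyl_sub sp sK n h.
  by rewrite -[LHS]/(uniform_prob _ _) uniform01_itv// cyl_width_ge0.
exists _, (measurableTypeR R), Pr, Z; split; last first.
  by move=> n h; rewrite PC cyl_widthE.
move=> t x.
(* The event [Z t = x] is the union of the finitely many cylinders of histories
   of length [t.+1] which end in [x]. *)
have -> : [set w | Z t w = x] =
    \bigcup_(h in [set h : {ffun 'I_t.+1 -> X} | h ord_max = x])
      C t (fun k => h (inord k)).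
  apply/seteqP; split=> [w /= Zw|w [h /= hx Cw]]; last first.
    rewrite /= Cw//; rewrite -hx; congr (h _).
    by apply: val_inj; rewrite /= inordK.
  exists [ffun k : 'I_t.+1 => Z k w]; first by rewrite /= ffunE.
  by move=> k kt; rewrite ffunE inordK.
by apply: fin_bigcup_measurable => [|h _]; [exact: finite_finset|exact: mC].
Qed.

(** * Expected discounted returns *)

Lemma preimage_level_sets {d : measure_display} {T : measurableType d}
    {X : finType} (Z : T -> X) (B : set X) :
  (forall x, measurable [set w | Z w = x]) -> measurable (Z @^-1` B).
Proof.
move=> mZ; have -> : Z @^-1` B = \bigcup_(x in B) [set w | Z w = x].
  by apply/seteqP; split=> [w Bw|w [x Bx Zx]]; [exists (Z w)|rewrite /= Zx].
by apply: fin_bigcup_measurable => //; exact: finite_finset.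
Qed.

Lemma integral_level_sets {R : realType} {d : measure_display}
    {T : measurableType d} (mu : {measure set T -> \bar R}) {X : finType}
    (Z : T -> X) (D : set T) (f : T -> R) :
  (forall x, measurable [set w | Z w = x]) -> measurable D ->
  measurable_fun D f ->
  (\int[mu]_(w in D) (f w)%:E =
   \sum_(x : X) \int[mu]_(w in D `&` [set w | Z w = x]) (f w)%:E)%E.
Proof.
move=> mZ mD mf.
have DE : D = \big[setU/set0]_(x <- enum X) (D `&` [set w | Z w = x]).
  apply/seteqP; split=> w; rewrite -bigcup_seq.
    by move=> Dw; exists (Z w) => //=; rewrite mem_enum.
  by move=> [x _ []].
rewrite {1}DE integral_bigsetU_EFin ?enum_uniq//.
- by rewrite big_enum.
- by move=> x; exact: measurableI.
- by apply/trivIsetP => x y _ _ /eqP xy; apply/seteqP; split=> // w [[_ Zx] [_ Zy]];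
  apply: xy; rewrite -[LHS]Zx.
- by rewrite -DE; exact/measurable_EFinP.
Qed.

Section expected_return.
Context {R : realType} {X : finType} (p : X -> R) (K : X -> X -> R).
Hypothesis sK : forall x, simplex (K x).
Context {d : measure_display} {T : measurableType d} (Pr : probability T R).
Context (Z : nat -> T -> X) (ZP : is_chain p K Pr Z).
Context (gamma : R) (r : X -> R).
Hypothesis gamma01 : 0 <= gamma < 1.

(** Expected discounted sum of the first [N] rewards of the chain from [x]. *)
Fixpoint chain_value (N : nat) (x : X) : R :=
  if N is M.+1 then r x + gamma * \sum_y K x y * chain_value M y else 0.

Definition partial_return (n N : nat) (w : T) : R :=
  \sum_(k < N) gamma ^+ k * r (Z (n + k) w).

Lemma partial_returnS n N w :
  partial_return n N.+1 w = r (Z n w) + gamma * partial_return n.+1 N w.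
Proof.
rewrite /partial_return big_ord_recl expr0 mul1r addn0; congr (_ + _).
rewrite mulr_sumr; apply: eq_bigr => k _.
by rewrite lift0 exprS mulrA addSnnS.
Qed.

Let M : R := \sum_x `|r x|.
Let B : R := M / (1 - gamma).

Let rM x : `|r x| <= M.
Proof. by rewrite /M (bigD1 x)//= lerDl sumr_ge0. Qed.

Lemma partial_return_bounded n N w : `|partial_return n N w| <= B.
Proof.
have /andP[g0 g1] := gamma01; have M0 : 0 <= M by rewrite sumr_ge0.
have B0 : 0 <= B by rewrite divr_ge0// subr_ge0 ltW.
elim: N n => [|N IHN] n; first by rewrite /partial_return big_ord0 normr0.
rewrite partial_returnS; apply: le_trans (ler_normD _ _) _.
rewrite normrM (ger0_norm g0).
have -> : B = M + gamma * B by rewrite /B; field; rewrite subr_eq0 gt_eqF.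
by rewrite lerD// ler_wpM2l.
Qed.

Lemma measurable_partial_return n N D : measurable_fun D (partial_return n N).
Proof.
apply: measurable_funTS; apply: measurable_sum => k.
apply: measurable_funM; first exact: measurable_cst.
move=> _ Y _; rewrite setTI.
exact: (@preimage_level_sets _ _ _ (Z (n + k)) (r @^-1` Y) (ZP.1 (n + k)%N)).
Qed.

Lemma integrable_partial_return n N D : measurable D ->
  Pr.-integrable D (EFin \o partial_return n N).
Proof.
move=> mD; apply: measurable_bounded_integrable => //.
- by rewrite (le_lt_trans (probability_le1 Pr mD)) ?ltry.
- exact: measurable_partial_return.
- exists B; split; first exact: num_real.
  by move=> x Bx w _ /=; apply: le_trans (partial_return_bounded _ _ _) (ltW Bx).
Qed.

Lemma measurable_cyl n (h : nat -> X) :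
  measurable [set w | forall t, (t <= n)%N -> Z t w = h t].
Proof.
have -> : [set w | forall t, (t <= n)%N -> Z t w = h t] =
    \bigcap_(t in [set` 'I_n.+1]) [set w | Z t w = h t].
  apply/seteqP; split=> w Cw t /=; first by move=> _; apply: Cw; rewrite -ltnS.
  by move=> tn; exact: (Cw (Ordinal (tn : (t < n.+1)%N))).
apply: fin_bigcap_measurable => [|t _]; first exact: finite_finpred.
exact: ZP.1.
Qed.

(** The Markov property, integrated over a cylinder instead of conditioned on it:
    splitting the cylinder along the next state [Z n.+1] expresses the
    integral through the cylinders of length [n.+2]. *)
Lemma integral_cyl_partial_return n N h :
  (\int[Pr]_(w in [set w | forall t, (t <= n)%N -> Z t w = h t])
     (partial_return n N w)%:E =
   (p (h 0%N) * \prod_(t < n) K (h t) (h t.+1) * chain_value N (h n))%:E)%E.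
Proof.
elim: N n h => [|N IHN] n h.
  rewrite mulr0; under eq_integral do rewrite /partial_return big_ord0.
  by rewrite integral_cst ?mul0e//; exact: measurable_cyl.
set C := [set w | _]; have mC : measurable C by exact: measurable_cyl.
set c := p _ * _.
pose ext y (k : nat) := if k == n.+1 then y else h k.
have extE y k : (k <= n)%N -> ext y k = h k.
  by move=> kn; rewrite /ext ltn_eqF.
have extS y : ext y n.+1 = y by rewrite /ext eqxx.
have CS y : C `&` [set w | Z n.+1 w = y] =
    [set w | forall t, (t <= n.+1)%N -> Z t w = ext y t].
  apply/seteqP; split=> w /= => [[Cw Zy] t|Cw].
    rewrite leq_eqVlt => /orP[/eqP ->|tn]; first by rewrite extS.
    by rewrite extE// Cw.
  split=> [t tn|]; last by rewrite Cw// extS.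
  by rewrite Cw ?extE// leqW.
have extW y : p (ext y 0%N) * \prod_(t < n.+1) K (ext y t) (ext y t.+1) =
    c * K (h n) y.
  rewrite extE// big_ord_recr /= mulrA extE// extS; congr (_ * _ * _).
  by apply: eq_bigr => t _; rewrite !extE// ltnW.
have PrS y : Pr (C `&` [set w | Z n.+1 w = y]) = (c * K (h n) y)%:E.
  by rewrite CS ZP.2 extW.
rewrite (integral_level_sets _ (ZP.1 n.+1))//;
  last exact: measurable_partial_return.
transitivity (\sum_y (c * K (h n) y * (r (h n) + gamma * chain_value N y))%:E)%E.
  apply: eq_bigr => y _.
  have mCy : measurable (C `&` [set w | Z n.+1 w = y]).
    by apply: measurableI => //; exact: ZP.1.
  transitivity (\int[Pr]_(w in C `&` [set w | Z n.+1 w = y])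
      ((r (h n))%:E + gamma%:E * (partial_return n.+1 N w)%:E))%E.
    apply: eq_integral => w; rewrite inE => -[Cw _].
    by rewrite partial_returnS EFinD EFinM Cw.
  rewrite integralD//; last 2 first.
  - exact: finite_measure_integrable_cst.
  - by apply: integrableZl => //; exact: integrable_partial_return.
  rewrite integral_cst// integralZl//; last exact: integrable_partial_return.
  rewrite [X in (_ * X + _)%E](PrS y) CS IHN extW extS -!EFinM -EFinD; congr (_%:E).
  by ring.
rewrite sumEFin; congr (_%:E); rewrite /=.
under eq_bigr do rewrite -mulrA mulrDr mulrCA.
rewrite -mulr_sumr big_split /= -mulr_suml (sK (h n)).2 mul1r -mulr_sumr.
by [].
Qed.

(** The expected partial returns converge to the expected return by dominated
    convergence, all of them being bounded by a geometric series. *)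
Theorem expectation_discounted_return (v : R) :
  (fun N => \sum_x p x * chain_value N x) @ \oo --> v ->
  ('E_Pr[fun w => limn (series (fun t => gamma ^+ t * r (Z t w)))%R] = v%:E)%E.
Proof.
move=> chv; have /andP[g0 g1] := gamma01.
have intE N : (\int[Pr]_w (partial_return 0 N w)%:E =
    (\sum_x p x * chain_value N x)%:E)%E.
  rewrite (integral_level_sets _ (ZP.1 0%N))//;
    last exact: measurable_partial_return.
  rewrite -sumEFin; apply: eq_bigr => x _.
  have := integral_cyl_partial_return 0 N (fun=> x); rewrite big_ord0 mulr1 => <-.
  congr (integral _ _ _); apply/seteqP; split=> w /=; first by move=> [_ <-] [].
  by move=> Cw; split=> //; exact: Cw.
have cvr w : partial_return 0 ^~ w @ \oo -->
    limn (series (fun t => gamma ^+ t * r (Z t w))).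
  have -> : partial_return 0 ^~ w =
      series (fun t => gamma ^+ t * r (Z t w)).
    by apply/funext => N; rewrite /series /= big_mkord.
  apply: normed_cvg; apply: (@series_le_cvg _ _ (geometric M gamma)) => //.
  - by move=> n /=; rewrite normr_ge0.
  - by move=> n; rewrite mulr_ge0 ?exprn_ge0// sumr_ge0.
  - move=> n /=; rewrite normrM ger0_norm ?exprn_ge0// mulrC.
    by rewrite ler_wpM2r ?exprn_ge0.
  - by apply: is_cvg_geometric_series; rewrite ger0_norm.
rewrite unlock.
have := @dominated_cvg _ _ _ Pr setT measurableT
  (fun N w => (partial_return 0 N w)%:E)
  (fun w => (limn (series (fun t => gamma ^+ t * r (Z t w))))%:E) (cst B%:E).
move=> dc.
have {}dc : (\int[Pr]_w (partial_return 0 N w)%:E @[N --> \oo] -->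
    \int[Pr]_w (limn (series (fun t => gamma ^+ t * r (Z t w))))%R%:E)%E.
  apply: dc => //.
  - by move=> N; apply/measurable_EFinP; exact: measurable_partial_return.
  - by move=> w _; apply: cvg_EFin; [exact: nearW|exact: cvr].
  - exact: finite_measure_integrable_cst.
  - by move=> N w _; rewrite /= lee_fin; exact: partial_return_bounded.
rewrite (funext intE) in dc; apply: (@cvg_unique _ (@ereal_hausdorff R) _ _ _ _ dc).
by apply: cvg_EFin; [exact: nearW|exact: chv].
Qed.

End expected_return.

(** * Value functions *)

Section policy_chain.
Context {R : realType} {S A : finType}.
Implicit Types (r : S * A -> R) (pi : S -> A -> R) (P : S * A -> S -> R).

(** Law of a state drawn from [q] followed by an action drawn from [pi]. *)
Definition state_action_law pi (q : S -> R) (x : S * A) : R := q x.1 * pi x.1 x.2.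

Lemma sum_state_action_law pi q (f : S * A -> R) :
  \sum_x state_action_law pi q x * f x = dotp q (fun s => \sum_a pi s a * f (s, a)).
Proof.
rewrite /dotp /state_action_law; under [RHS]eq_bigr do rewrite mulr_sumr.
by rewrite pair_bigA; apply: eq_bigr => -[s a] _ /=; rewrite mulrA.
Qed.

Lemma state_action_law_simplex pi q : policies pi -> simplex q ->
  simplex (state_action_law pi q).
Proof.
move=> ppi [q0 q1]; split=> [x|].
  by rewrite mulr_ge0//; case: (ppi x.1).
have := sum_state_action_law pi q (fun=> 1).
under eq_bigr do rewrite mulr1; move=> ->.
rewrite -[RHS]q1.
apply: eq_bigr => s _.
under eq_bigr do rewrite mulr1.
by rewrite (ppi s).2 mulr1.
Qed.

Definition point_mass (s : S) : S -> R := fun s' => (s' == s)%:R.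

Lemma dotp_point_mass s (f : S -> R) : dotp (point_mass s) f = f s.
Proof.
rewrite /dotp (bigD1 s)//= /point_mass eqxx mul1r big1 ?addr0// => s' /negbTE ->.
by rewrite mul0r.
Qed.

Lemma point_mass_simplex s : simplex (point_mass s).
Proof.
split=> [s'|]; first exact: ler0n.
rewrite -[RHS](dotp_point_mass s (fun=> 1)).
by apply: eq_bigr => s' _; rewrite mulr1.
Qed.

Lemma is_trajectoryE pi P s d (T : measurableType d) (Pr : probability T R) Z :
  is_trajectory pi P s Pr Z <->
  is_chain (state_action_law pi (point_mass s))
    (fun x => state_action_law pi (P x)) Pr Z.
Proof.
suff wE n h : (((h 0%N).1 == s)%:R * \prod_(t < n.+1) pi (h t).1 (h t).2 *
    \prod_(t < n) P (h t) (h t.+1).1) =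
    state_action_law pi (point_mass s) (h 0%N) *
    \prod_(t < n) state_action_law pi (P (h t)) (h t.+1).
  by split=> -[mZ law]; split=> // n h; rewrite law wE.
rewrite big_split /= big_ord_recl /state_action_law /point_mass /=.
rewrite -!mulrA; congr (_ * (_ * _)); exact: mulrC.
Qed.

(** The expected partial returns are the Bellman iterates of [0], which converge to
    the fixed point [w]; so every trajectory has expected return [w], and a
    trajectory exists. *)
Lemma value_bellman P gamma r pi : (forall sa, simplex (P sa)) ->
    policies pi -> 0 <= gamma < 1 ->
  forall s, value gamma r pi P s =
    \sum_a pi s a * (r (s, a) + gamma * dotp (P (s, a)) (value gamma r pi P)).
Proof.
move=> sP ppi g01.
pose F v s := \sum_a pi s a * (r (s, a) + gamma * dotp (P (s, a)) v).
have [|w Fw itw] := @blackwell_fixpoint _ _ gamma g01 F _ (fun=> 0).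
  move=> u v M uvM s; apply: policy_leB => // a.
  have /andP[g0 _] := g01; rewrite opprD addrACA subrr add0r -mulrBr.
  by apply: ler_wpM2l => //; exact: dotp_simplexB.
suff -> : value gamma r pi P = w by move=> s; rewrite -{1}Fw.
apply/funext => s.
pose p := state_action_law pi (point_mass s); pose K x := state_action_law pi (P x).
have sp : simplex p.
  by apply: state_action_law_simplex => //; exact: point_mass_simplex.
have sK x : simplex (K x) by apply: state_action_law_simplex.
have chE N : \sum_x p x * chain_value K gamma r N x = iter N F (fun=> 0) s.
  rewrite sum_state_action_law dotp_point_mass; elim: N s {p sp} => [|N IHN] s /=.
    by rewrite big1 // => a _; rewrite mulr0.
  apply: eq_bigr => a _; rewrite sum_state_action_law; congr (_ * (_ + _ * dotp _ _)).
  by apply/funext => s'; exact: IHN.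
have EE d (T : measurableType d) (Pr : probability T R) Z :
    is_trajectory pi P s Pr Z ->
    ('E_Pr[fun w => discounted_return gamma r (fun t => Z t w)] = (w s)%:E)%E.
  move=> /is_trajectoryE ZP.
  apply: (expectation_discounted_return sK ZP g01).
  by rewrite (funext chE).
have [d [T [Pr [Z ZP]]]] := chain_exists sp sK.
have /(@getPex R) : exists x : R,
    exists (d : measure_display) (T : measurableType d) (Pr : probability T R)
      (Z : nat -> T -> S * A),
      is_trajectory pi P s Pr Z /\
      ('E_Pr[fun w => discounted_return gamma r (fun t => Z t w)] = x%:E)%E.
  exists (w s), d, T, Pr, Z.
  have ZP' : is_trajectory pi P s Pr Z by apply/is_trajectoryE.
  by split=> //; exact: EE.
by move=> [d' [T' [Pr' [Z' [/EE ->]]]]] [].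
Qed.

End policy_chain.

(** * The equivalences *)

Lemma uniform_simplex {R : realType} {E : finType} : (0 < #|E|)%N ->
  simplex (fun _ : E => #|E|%:R^-1 : R).
Proof.
move=> E0; split=> [e|]; first by rewrite invr_ge0 ler0n.
by rewrite sumr_const -[_ *+ _]mulr_natr mulVf// pnatr_eq0 -lt0n.
Qed.

Section equivalence.
Context {R : realType} {S A : finType} (U : set (kernel_space R S A)).
Hypothesis HU : uncertainty_set U.
Implicit Types (r : S * A -> R) (pi : S -> A -> R) (P : kernel_space R S A).

Definition uhat_realized : Prop :=
  forall pi r gamma, policies pi -> 0 <= gamma < 1 ->
    exists2 P, U P & uhat U gamma r pi = value gamma r pi P.

Definition common_argmin : Prop :=
  forall u : S -> R, (\bigcap_(sa in [set: S * A])
    argmin U (fun P : kernel_space R S A => dotp (P sa) u)) !=set0.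

(** A value function solves the robust equation of a singleton, which is a smaller
    uncertainty set. *)
Lemma uhat_le_value gamma r pi P : policies pi -> 0 <= gamma < 1 -> U P ->
  forall s, uhat U gamma r pi s <= value gamma r pi P s.
Proof.
move=> ppi g01 UP; have [_ _ sU] := HU.
apply: (@sa_robust_bellman_le _ _ _ U [set P] gamma r pi _ _ _ _ ppi g01).
- by move=> _ ->.
- by move=> _ -> sa; exact: sU.
- exact: uhatP.
- by apply/sa_robust_bellman1; apply: value_bellman => // sa; exact: sU.
Qed.

Lemma value_unique gamma r pi P u : policies pi -> 0 <= gamma < 1 -> U P ->
    (forall s, u s = \sum_a pi s a * (r (s, a) + gamma * dotp (P (s, a)) u)) ->
  u = value gamma r pi P.
Proof.
move=> ppi g01 UP ub; have [_ _ sU] := HU.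
apply: (@sa_robust_bellman_unique _ _ _ [set P] gamma r pi) => //.
- by apply: uncertainty_set1; exact: sU.
- exact/sa_robust_bellman1.
- by apply/sa_robust_bellman1; apply: value_bellman => // sa; exact: sU.
Qed.

Lemma common_argmin_realized : (0 < #|S|)%N -> (0 < #|A|)%N ->
  common_argmin -> uhat_realized.
Proof.
move=> /card_gt0P[s0 _] /card_gt0P[a0 _] cm pi r gamma ppi g01.
set u := uhat _ _ _ _; have /andP[g0 _] := g01.
have [P Pcap] := cm u.
have Pmin sa : argmin U (fun Q : kernel_space R S A => dotp (Q sa) u) P.
  exact: Pcap.
have [UP _] := Pmin (s0, a0).
exists P => //; apply: value_unique => // s.
have [m [mP um]] := uhatP r HU ppi g01 s; rewrite [u s]um.
apply: eq_bigr => a _; congr (_ * _); apply: is_min_unique (mP a) _.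
exists P => //; split=> // Q UQ.
by rewrite lerD2l ler_wpM2l// (Pmin (s, a)).2.
Qed.

Lemma realized_tractable : uhat_realized -> weakly_sa_tractable U.
Proof.
move=> real pi r gamma mu ppi g01 [mu0 _].
have [P UP uP] := real pi r gamma ppi g01.
exists P; last by rewrite uP.
split=> // Q UQ; rewrite -uP; apply: ler_sum => s _.
by rewrite ler_wpM2l// uhat_le_value.
Qed.

(** Tractability for the uniform [mu] suffices: [value - uhat] is nonnegative by
    [uhat_le_value], and its average with positive weights vanishes. *)
Lemma tractable_realized : (0 < #|S|)%N ->
  weakly_sa_tractable U -> uhat_realized.
Proof.
move=> S0 tr pi r gamma ppi g01.
have [P [UP _] uP] := tr pi r gamma _ ppi g01 (uniform_simplex S0).
exists P => //; apply/funext => s.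
have le := uhat_le_value r ppi g01 UP.
apply/eqP; rewrite eq_le le /=.
rewrite -subr_le0.
have /(_ s isT) -> // : forall t, true ->
    value gamma r pi P t - uhat U gamma r pi t = 0.
have ge0 t : true -> 0 <= value gamma r pi P t - uhat U gamma r pi t.
  by rewrite subr_ge0.
apply: (psumr_eq0P ge0); rewrite sumrB; apply/eqP; rewrite subr_eq0.
have cardS : (#|S|%:R^-1 : R) != 0 by rewrite invr_eq0 pnatr_eq0 -lt0n.
by move: uP; rewrite /dotp -!mulr_sumr => /(mulfI cardS) ->.
Qed.

(** The rewards [r] give every action in [s] the robust value [u s], so that
    [uhat = u].  If [u] is also the value function of [P], the nonnegative gaps
    between the action values under [P] and their minima have zero average
    under the uniform policy, hence vanish. *)
Lemma realized_common_argmin : (0 < #|A|)%N -> uhat_realized -> common_argmin.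
Proof.
move=> A0 real u; pose c : R := 2^-1.
have c0 : 0 < c by rewrite invr_gt0.
have c01 : 0 <= c < 1 by rewrite ltW//= invf_lt1// ltr1n.
have [m mP] := choice (fun sa => bellman_min_exists c (fun=> 0) u sa HU).
pose r (sa : S * A) := u sa.1 - m sa.
pose pi (s : S) (a : A) : R := #|A|%:R^-1.
have ppi : policies pi by move=> s; exact: uniform_simplex.
have rP s a : is_min U (fun P => r (s, a) + c * dotp (P (s, a)) u) (u s).
  have [P [UP Pmin] Pm] := mP (s, a).
  exists P; last by rewrite /r -Pm /= add0r subrK.
  by split=> // Q UQ; rewrite lerD2l; have := Pmin Q UQ; rewrite !add0r.
have uE : uhat U c r pi = u.
  apply: uhat_unique => // s; exists (fun=> u s).
  split; first by move=> a; exact: rP.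
  by rewrite -mulr_suml (ppi s).2 mul1r.
have [P UP] := real pi r c ppi c01; rewrite uE => uP.
have [_ _ sU] := HU.
exists P => -[s a] _; split=> // Q UQ.
have [P' [_ P'min] P'u] := rP s a.
have ge0 b : true -> 0 <= r (s, b) + c * dotp (P (s, b)) u - u s.
  by move=> _; rewrite subr_ge0; have [P1 [_ P1min] <-] := rP s b; exact: P1min.
have cardA : (#|A|%:R^-1 : R) != 0 by rewrite invr_eq0 pnatr_eq0 -lt0n.
have /(psumr_eq0P ge0)/(_ a isT)/subr0_eq Pu :
    \sum_b (r (s, b) + c * dotp (P (s, b)) u - u s) = 0.
  apply: (mulfI cardA); rewrite mulr0 mulr_sumr.
  under eq_bigr do rewrite mulrBr; rewrite sumrB -mulr_suml (ppi s).2 mul1r.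
  apply/eqP; rewrite subr_eq0 eq_sym {1}uP value_bellman -?uP//.
  exact: sU.
have := P'min Q UQ; rewrite P'u -Pu lerD2l.
by rewrite ler_pM2l.
Qed.

End equivalence.

Theorem theorem10 (R : realType) (S A : finType)
    (S_nonempty : (0 < #|S|)%N) (A_nonempty : (0 < #|A|)%N)
    (U : set (kernel_space R S A))
    (U_kernels : forall P, U P -> forall sa : S * A, simplex (P sa))
    (U_nonempty : U !=set0) (U_compact : compact U) :
  (weakly_sa_tractable U <->
   (forall (pi : S -> A -> R) (r : S * A -> R) (gamma : R),
      policies pi -> 0 <= gamma < 1 ->
      exists2 P, U P & uhat U gamma r pi = value gamma r pi P)) /\
  ((forall (pi : S -> A -> R) (r : S * A -> R) (gamma : R),
      policies pi -> 0 <= gamma < 1 ->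
      exists2 P, U P & uhat U gamma r pi = value gamma r pi P) <->
   (forall V : S -> R,
      (\bigcap_(sa in [set: S * A])
          argmin U (fun P : kernel_space R S A => dotp (P sa) V)) !=set0)).
Proof.
have HU : uncertainty_set U by [].
have realized_iff : uhat_realized U <-> common_argmin U.
  split; first exact: realized_common_argmin.
  exact: common_argmin_realized.
split; last exact: realized_iff.
split; first exact: tractable_realized.
exact: realized_tractable.
Qed.
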